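(* Let $\varepsilon\in(0,1/24)$ and let $p=p(n)$ satisfy $n^{5/8+\varepsilon}\le np\ll n^{2/3}$. Let $k=\lceil 15p^{-2}(n^{-1}\log n)^{1/2}\rceil$, and let $(Z_\ell)_{\ell=1}^{2k}$ be independent random variables with $Z_\ell\in\mathrm{Bin}(z_\ell,p)$, where $$z_\ell=n-(\ell-1)np+\tfrac12(\ell-1)(\ell-2)np^2 .$$ Let $Z^{(1)}=\max\{Z_\ell:\ell\in[2k]\}$. Then $$\frac{Z^{(1)}-np}{\sqrt{np\log(1/(np^3))}}\ \xrightarrow{\ \mathbb P\ }\ 1\qquad\text{as }n\to\infty,$$ where the convergence is in probability.
   Context: $[m]=\{1,\dots,m\}$; $f\ll g$ means $f=o(g)$ as $n\to\infty$; $Z\in\mathrm{Bin}(z,p)$ means that $Z$ is binomially distributed with parameters $z$ and $p$. Quantities such as $z_\ell$ that must be integers are understood to be rounded up or down. *)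

(* Defs.v *)
From HB Require Import structures.
From mathcomp Require Import all_boot all_order all_algebra.
From mathcomp Require Import finmap.
From mathcomp Require Import all_classical all_reals all_analysis.

Set Implicit Arguments.
Unset Strict Implicit.
Unset Printing Implicit Defensive.

Import Order.TTheory GRing.Theory Num.Theory.
Import numFieldNormedType.Exports.

Local Open Scope classical_set_scope.
Local Open Scope ring_scope.

(* Mutual independence of the random variables X i, i in D: the product rule
   for every finite subfamily. *)
Definition mutually_independent (d d' : measure_display)
    (T : measurableType d) (T' : measurableType d') (R : realType)
    (P : probability T R) (I : choiceType) (D : set I)
    (X : I -> {RV P >-> T'}) : Prop :=
  forall (J : {fset I}) (A : I -> set T'),
    [set` J] `<=` D ->
    (forall i, i \in J -> measurable (A i)) ->
    P (\bigcap_(i in [set` J]) (X i @^-1` A i)) =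
      (\prod_(i <- J) P (X i @^-1` A i))%E.

(* The n-th variable lives on its own probability space.  The X n are plain
   functions: this is meant for measurable ones. *)
Definition cvg_in_probability (R : realType) (d : nat -> measure_display)
    (T : forall n, measurableType (d n)) (P : forall n, probability (T n) R)
    (X : forall n, T n -> R) (c : R) : Prop :=
  forall e : R, 0 < e ->
    P n [set t | e < `|X n t - c|] @[n --> \oo] --> 0%E.

Definition rounding (R : realType) (x : R) (m : nat) : Prop :=
  m%:Z = Num.floor x \/ m%:Z = Num.ceil x.

(* The absolute value only converts int to nat: the argument is nonnegative. *)
Definition kpar (R : realType) (n : nat) (p : R) : nat :=
  `|Num.ceil (15 * p ^- 2 * Num.sqrt (n%:R^-1 * ln n%:R))|%N.

Definition zpar (R : realType) (n : nat) (p : R) (l : nat) : R :=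
  n%:R - (l%:R - 1) * (n%:R * p)
  + 2^-1 * (l%:R - 1) * (l%:R - 2) * (n%:R * p ^+ 2).

(* Main.v *)
(** Put s = sqrt(np), L = log(1/(np^3)), t = sqrt L; then the l-th mean drops
    below np by about (l-1)np^2, and np^2 = s * exp(-L/2).  So about exp(L/2) of
    the Z_l have mean np - O(s), and the later ones have rapidly smaller means.
    Upper bound: Chernoff's bound with parameter t/s gives
    P(Z_l >= np + (1+e)st) <= C exp(-(1+e)L/2) r^(l-1), r = exp(-exp(-L/2)/2),
    and the geometric series contributes only a factor O(exp(L/2)).
    Lower bound: tilting Bin(z, p) to Bin(z, p exp((1-e/2)t/s)), together with
    Chebyshev's inequality for the tilted law, shows that each of the first
    exp(L/2) variables exceeds np + (1-e)st with probability at least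
    (3/4) exp(-(1-e/8)L/2); by independence one of them does. *)

Require Import Defs.
From HB Require Import structures.
From mathcomp Require Import all_boot all_order all_algebra.
From mathcomp Require Import finmap.
From mathcomp Require Import all_classical all_reals all_analysis.
From mathcomp Require Import ring lra.

Set Implicit Arguments.
Unset Strict Implicit.
Unset Printing Implicit Defensive.

Import Order.TTheory GRing.Theory Num.Theory.
Import numFieldNormedType.Exports.

Local Open Scope classical_set_scope.
Local Open Scope ring_scope.

(** * Quadratic bounds for the exponential *)

(** Follows from e^x >= 1 + x + x^2/2, because (1 - x + x^2/2)(1 + x + x^2/2) = 1 + x^4/4 >= 1. *)
Lemma expRN_le_quadratic (R : realType) (x : R) : 0 <= x ->
  expR (- x) <= 1 - x + x ^+ 2 / 2.
Proof.
move=> x0.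
have h : forall y : R, 0 <= y -> 1 + y + y ^+ 2 / 2 <= expR y.
  move=> y y0; pose f (z : R) := expR z - (1 + z + z ^+ 2 / 2).
  have fd (z : R) : is_derive z 1 f (expR z - (1 + z)).
    rewrite /f; apply: is_derive_eq.
    by rewrite /GRing.scale /= ?mulr0; field.
  have : f 0 <= f y.
    apply: (@ger0_derive1_le_cc R f 0 y) => //.
    - move=> u; rewrite in_itv /= => /andP[u0 _].
      by rewrite derive1E (@derive_val _ _ _ _ _ _ _ (fd u)) subr_ge0 expR_ge1Dx.
    - by apply: derivable_within_continuous => z _; exact: ex_derive.
    - by rewrite in_itv /= lexx y0.
    - by rewrite in_itv /= lexx y0.
  by rewrite /f expR0; lra.
rewrite expRN; have := h _ x0; have e0 := expR_gt0 x => hx.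
rewrite -(ler_pM2r e0) mulVf ?gt_eqF//.
have p0 : 0 <= 1 - x + x ^+ 2 / 2 by nra.
apply: le_trans (ler_wpM2l p0 hx); nra.
Qed.

(** After division by e^x this is f(0) <= f(x) for f(z) = (1 + z)e^(-z) + z^2/2, whose derivative
    z(1 - e^(-z)) is nonnegative. *)
Lemma expR_le_quadratic (R : realType) (x : R) : 0 <= x ->
  expR x <= 1 + x + expR x * x ^+ 2 / 2.
Proof.
move=> x0; pose f (z : R) := (1 + z) * expR (- z) + z ^+ 2 / 2.
have fd (z : R) : is_derive z 1 f (z * (1 - expR (- z))).
  rewrite /f; apply: is_derive_eq.
  by rewrite /GRing.scale /= ?mulr0; field.
have : f 0 <= f x.
  apply: (@ger0_derive1_le_cc R f 0 x) => //.
  - move=> u; rewrite in_itv /= => /andP[u0 _].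
    rewrite derive1E (@derive_val _ _ _ _ _ _ _ (fd u)) mulr_ge0 ?(ltW u0)// subr_ge0.
    by rewrite expR_le1 oppr_le0 ltW.
  - by apply: derivable_within_continuous => z _; exact: ex_derive.
  - by rewrite in_itv /= lexx x0.
  - by rewrite in_itv /= lexx x0.
rewrite /f oppr0 expR0 expRN => h; have e0 := expR_gt0 x.
have : expR x * 1 <= expR x * ((1 + x) / expR x + x ^+ 2 / 2).
  by rewrite ler_pM2l//; apply: le_trans h; lra.
rewrite mulr1 mulrDr mulrCA divff ?gt_eqF//; lra.
Qed.

(** * Moments and tails of the binomial law *)

(** Conditioning on one trial, proved by Pascal's rule. It drives the inductions for the total mass,
    the moment generating function and the variance. *)
Lemma expectation_binomial_pmfS (R : realType) (p : R) (m : nat) (f : nat -> R) :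
  \sum_(k < m.+2) binomial_pmf m.+1 p k * f k =
  \sum_(k < m.+1) binomial_pmf m p k * (p * f k.+1 + (1 - p) * f k).
Proof.
under [RHS]eq_bigr do rewrite mulrDr.
rewrite /binomial_pmf /unstable.onem big_split /= big_ord_recl /= addrC.
have -> : \sum_(k < m.+1) (p ^+ k * (1 - p) ^+ (m - k) *+ 'C(m, k)) * ((1 - p) * f k) =
   \sum_(k < m.+1) p ^+ k.+1 * (1 - p) ^+ (m - k) *+ 'C(m, k.+1) * f k.+1 +
   p ^+ 0 * (1 - p) ^+ (m.+1 - 0) *+ 'C(m.+1, 0) * f 0%N.
  rewrite [LHS]big_ord_recl [X in _ = X + _]big_ord_recr /=.
  rewrite (@bin_small m m.+1)// mulr0n mul0r addr0 addrC.
  congr (_ + _).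
    apply: eq_bigr => i _; rewrite /bump /= add1n.
    have -> : (m - i = (m - i.+1).+1)%N by rewrite subnSK.
    by rewrite !mulrnAl [(1 - p) ^+ _.+1]exprSr; congr (_ *+ _); ring.
  by rewrite !bin0 !subn0 [_ ^+ m.+1]exprSr; ring.
rewrite addrAC [RHS]addrC; congr (_ + _); rewrite -big_split; apply: eq_bigr => i _ /=.
rewrite /bump /= add1n subSS binS mulrnDr mulrDl; congr (_ + _).
by rewrite exprS !mulrnAl; congr (_ *+ _); ring.
Qed.

Lemma binomial_pmf_sum1 (R : realType) (p : R) (m : nat) :
  \sum_(k < m.+1) binomial_pmf m p k = 1.
Proof.
elim: m => [|m IH].
  by rewrite big_ord1 /binomial_pmf /= bin0 mulr1 expr0.
under eq_bigr do rewrite -[binomial_pmf _ _ _]mulr1.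
rewrite (expectation_binomial_pmfS p m (fun=> 1)) -[RHS]IH.
by apply: eq_bigr => k _; ring.
Qed.

Lemma binomial_pmf_mgf (R : realType) (p x : R) (m : nat) :
  \sum_(k < m.+1) binomial_pmf m p k * expR (x * k%:R) =
  (1 + p * (expR x - 1)) ^+ m.
Proof.
elim: m => [|m IH].
  by rewrite big_ord1 /binomial_pmf /= bin0 mulr0 expR0 !mulr1 expr0.
rewrite (expectation_binomial_pmfS p m (fun k => expR (x * k%:R))) exprS -IH.
rewrite mulr_sumr; apply: eq_bigr => k _.
rewrite -[k.+1%:R]natr1 [x * (_ + 1)]mulrDr mulr1 expRD; ring.
Qed.

(** The centre [c] is arbitrary because a success in the recursion replaces [c] by [c - 1]. *)
Lemma binomial_pmf_variance (R : realType) (p c : R) (m : nat) :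
  \sum_(k < m.+1) binomial_pmf m p k * (k%:R - c) ^+ 2 =
  m%:R * p * (1 - p) + (m%:R * p - c) ^+ 2.
Proof.
elim: m c => [|m IH] c.
  by rewrite big_ord1 /binomial_pmf /= bin0 expr0; ring.
rewrite (expectation_binomial_pmfS p m (fun k => (k%:R - c) ^+ 2)).
transitivity (p * \sum_(k < m.+1) binomial_pmf m p k * (k%:R - (c - 1)) ^+ 2 +
   (1 - p) * \sum_(k < m.+1) binomial_pmf m p k * (k%:R - c) ^+ 2).
  rewrite !mulr_sumr -big_split; apply: eq_bigr => k _ /=.
  by rewrite -[k.+1%:R]natr1; ring.
by rewrite !IH -[m.+1%:R]natr1; ring.
Qed.

(** Markov's inequality for e^(xk), followed by 1 + u <= e^u in each factor of the generating
    function. *)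
Lemma binomial_upper_tail_chernoff (R : realType) (p x a : R) (m : nat) :
  0 <= p <= 1 -> 0 <= x ->
  \sum_(k < m.+1 | a <= k%:R) binomial_pmf m p k <=
  expR (m%:R * p * (expR x - 1) - x * a).
Proof.
move=> p01 x0; have [p0 p1] := andP p01.
have q0 k : 0 <= binomial_pmf m p k by exact: binomial_pmf_ge0.
apply: (@le_trans _ _ ((1 + p * (expR x - 1)) ^+ m * expR (- (x * a)))).
  rewrite -binomial_pmf_mgf mulr_suml big_mkcond /=; apply: ler_sum => k _.
  rewrite -mulrA -expRD; case: ifPn => [ak|_]; last first.
    by rewrite mulr_ge0 ?expR_ge0.
  rewrite ler_peMr// -[leLHS]expR0 ler_expR -mulrBr mulr_ge0//.
  by rewrite subr_ge0.
rewrite expRD ler_wpM2r ?expR_ge0//.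
rewrite -mulrA expRM_natl.
rewrite lerXn2r ?nnegrE ?expR_ge0 ?expR_ge1Dx//.
by rewrite addr_ge0// mulr_ge0// subr_ge0 -expR0 ler_expR.
Qed.

Lemma binomial_chebyshev (R : realType) (p r : R) (m : nat) :
  0 <= p <= 1 -> 0 <= r -> 4 * (m%:R * p) <= r ^+ 2 ->
  3 / 4 <= \sum_(k < m.+1 | `|k%:R - m%:R * p| <= r) binomial_pmf m p k.
Proof.
move=> p01 r0 mr; have [p0 p1] := andP p01.
have q0 k : 0 <= binomial_pmf m p k by exact: binomial_pmf_ge0.
(* The main argument multiplies by r^2 > 0. If r = 0, then mp = 0, the second moment vanishes and
   all mass sits at 0. *)
have [r00|rn0] := eqVneq r 0.
  have mp0 : m%:R * p = 0.
    by have : 0 <= m%:R * p by [exact: mulr_ge0]; rewrite r00 in mr; lra.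
  have := binomial_pmf_variance p 0 m.
  rewrite mp0 mul0r add0r subrr expr0n /= => /eqP.
  rewrite psumr_eq0; last by move=> k _; rewrite mulr_ge0// sqr_ge0.
  move=> /allP h; rewrite [leRHS](_ : _ = 1); first lra.
  rewrite -[RHS](binomial_pmf_sum1 p m) [LHS]big_mkcond; apply: eq_bigr => k _ /=.
  case: ifPn => // kr; have := h k (mem_index_enum _).
  rewrite subr0 mulf_eq0 expf_eq0 /= => /orP[/eqP -> //|/eqP k0].
  by move: kr; rewrite k0 subrr normr0 r0.
have r2 : 0 < r ^+ 2 by rewrite exprn_gt0// lt_def rn0.
have := binomial_pmf_sum1 p m.
rewrite (bigID (fun k : 'I_ _ => `|k%:R - m%:R * p| <= r)) /= => h1.
suff : \sum_(k < m.+1 | ~~ (`|k%:R - m%:R * p| <= r)) binomial_pmf m p k <= 4^-1.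
  by lra.
rewrite -(ler_pM2r r2); apply: (@le_trans _ _ (m%:R * p)); last lra.
apply: (@le_trans _ _ (m%:R * p * (1 - p))); last first.
  by rewrite ler_piMr ?mulr_ge0//; lra.
have := binomial_pmf_variance p (m%:R * p) m.
rewrite subrr expr0n addr0 => <-.
rewrite mulr_suml big_mkcond /=; apply: ler_sum => k _.
case: ifPn => [|_]; last by rewrite mulr_ge0// sqr_ge0.
rewrite -ltNge => rk; rewrite ler_wpM2l//.
by rewrite -(real_normK (num_real (k%:R - _))) lerXn2r ?nnegrE ?normr_ge0// ltW.
Qed.

(* Exponential tilting: [binomial_pmf m p k] equals
   [binomial_pmf m (p e^x) k * e^(- x k) * ((1 - p) / (1 - p e^x))^(m - k)],
   and the tilted law puts mass at least 3/4 within [r] of its mean. *)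
Lemma binomial_upper_tail_ge (R : realType) (p x r : R) (m : nat) :
  0 < p -> 0 <= x -> p * expR x < 1 -> 0 <= r ->
  4 * (m%:R * (p * expR x)) <= r ^+ 2 ->
  3 / 4 * expR (- (m%:R * p * expR x * x ^+ 2 / 2 + r * x
                  + p * (expR x - 1) * (m%:R * p * expR x + r))) <=
  \sum_(k < m.+1 | m%:R * p * expR x - r <= k%:R) binomial_pmf m p k.
Proof.
move=> p0 x0 p'1 r0 mr; set p' := p * expR x.
have ex1 : 1 <= expR x by rewrite -expR0 ler_expR.
have p'0 : 0 < p' by rewrite mulr_gt0// expR_gt0.
have pp' : p <= p' by rewrite ler_peMr// ltW.
have p'01 : 0 <= p' <= 1 by rewrite !ltW.
have p01 : 0 <= p <= 1 by rewrite (ltW p0)/= (le_trans pp')// ltW.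
have q0 k : 0 <= binomial_pmf m p k by exact: binomial_pmf_ge0.
rewrite -[m%:R * p * expR x]mulrA -/p'.
set C := expR _.
apply: (@le_trans _ _ (\sum_(k < m.+1 | `|k%:R - m%:R * p'| <= r)
   binomial_pmf m p' k * C)).
  by rewrite -mulr_suml ler_wpM2r ?expR_ge0// binomial_chebyshev.
rewrite [leLHS]big_mkcond [leRHS]big_mkcond /=; apply: ler_sum => k _.
have [kr|_] := ifPn; last by case: ifPn.
have [kl ku] : m%:R * p' - r <= k%:R /\ k%:R <= m%:R * p' + r.
  by move: kr; rewrite ler_norml => /andP[? ?]; split; lra.
rewrite kl {2}/binomial_pmf.
have km : (k <= m)%N by rewrite -ltnS.
have -> : p ^+ k = p' ^+ k * expR (- (x * k%:R)).
  by rewrite /p' exprMn -expRM_natr -mulrA -expRD subrr expR0 mulr1.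
(* Each failure contributes a factor (1 - p)/(1 - p') >= e^u with u = p(e^x - 1), since 1 - p' <= (1
   - p)(1 - u) <= (1 - p)e^(-u). *)
have h1 : (1 - p') ^+ (m - k) * expR ((m - k)%:R * (p * (expR x - 1))) <= (1 - p) ^+ (m - k).
  rewrite expRM_natl -exprMn lerXn2r ?nnegrE ?mulr_ge0 ?expR_ge0//.
  - by rewrite subr_ge0 ltW.
  - by rewrite subr_ge0; case/andP: p01.
  have u0 : 0 <= p * (expR x - 1) by rewrite mulr_ge0 ?(ltW p0)// subr_ge0.
  have d1 : (1 - p') <= (1 - p) * expR (- (p * (expR x - 1))).
    apply: (@le_trans _ _ ((1 - p) * (1 - p * (expR x - 1)))).
      rewrite /p'; nra.
    rewrite ler_wpM2l//; first by rewrite subr_ge0; case/andP: p01.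
    exact: expR_ge1Dx.
  apply: (le_trans (ler_wpM2r (expR_ge0 _) d1)).
  by rewrite -mulrA -expRD addNr expR0 mulr1.
rewrite /binomial_pmf mulrnAl lerMn2r; apply/orP; right.
rewrite -!mulrA ler_wpM2l ?exprn_ge0 ?(ltW p'0)//.
apply: le_trans (ler_wpM2l (expR_ge0 _) h1).
rewrite mulrCA ler_wpM2l ?exprn_ge0//; first by rewrite subr_ge0 ltW.
rewrite /C -expRD ler_expR natrB//.
(* Multiplied by e^x, the quadratic bound gives e^x - 1 - x e^x >= - e^x x^2/2, which controls the
   main term of the exponent. *)
have := expRN_le_quadratic x0; rewrite expRN => h2.
have h3 : 1 <= expR x * (1 - x + x ^+ 2 / 2).
  by rewrite -ler_pdivrMl ?expR_gt0// mulr1.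
have m0 : 0 <= m%:R * p by rewrite mulr_ge0// ltW.
have h4 := ler_wpM2l m0 h3.
have h5 : x * k%:R <= x * (m%:R * p' + r) by rewrite ler_wpM2l.
have h6 : p * (expR x - 1) * k%:R <= p * (expR x - 1) * (m%:R * p' + r).
  by rewrite ler_wpM2l// mulr_ge0 ?(ltW p0)// subr_ge0.
rewrite -/p' in h4 h5 h6 *.
have -> : (m%:R - k%:R) * (p * (expR x - 1)) =
  m%:R * p * (expR x - 1) - p * (expR x - 1) * k%:R by ring.
have e1 : m%:R * p' = m%:R * p * expR x by rewrite mulrA.
move: h5 h6; rewrite e1 => h5 h6.
lra.
Qed.

(** * Geometric series and binomial tails at the scale of the maximum *)

(** The sum is at most 1/(1 - e^(-u)), and e^(-u) <= 1/(1 + u). *)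
Lemma sum_expRN_le (R : realType) (u : R) (K : nat) : 0 < u ->
  \sum_(l < K) expR (- u) ^+ l <= 1 + u^-1.
Proof.
move=> u0; have := subrX1 (expR (- u)) K.
have r0 := expR_gt0 (- u); set S := \sum_(l < K) _ => hS.
have rK : 0 <= expR (- u) ^+ K by rewrite exprn_ge0// ltW.
have S0 : 0 <= S by apply: sumr_ge0 => i _; rewrite exprn_ge0// ltW.
have r1 : expR (- u) <= (1 + u)^-1.
  by rewrite expRN lef_pV2 ?posrE ?expR_gt0 ?expR_ge1Dx// addr_gt0.
have : (1 - (1 + u)^-1) * S <= 1.
  by apply: le_trans (ler_wpM2r S0 (lerB (lexx 1) r1)) _; lra.
have -> : 1 - (1 + u)^-1 = (1 + u^-1)^-1 :> R by field; rewrite !gt_eqF ?addr_gt0.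
by rewrite ler_pdivrMl ?mulr1// addr_gt0// invr_gt0.
Qed.

(* [t / s] is the optimal Chernoff parameter at the level of the maximum. *)
Lemma binomial_upper_tail_scaled (R : realType) (N p s t e : R) (m l : nat) :
  0 < p <= 1 -> 0 < s -> s ^+ 2 = N * p -> 1 <= t -> 0 <= e <= 1 ->
  N * p ^+ 2 / s = expR (- (t ^+ 2 / 2)) -> expR (t / s) <= 1 + e ->
  m%:R * p <= N * p - l%:R * (N * p ^+ 2) / 2 + p ->
  \sum_(k < m.+1 | N * p + (1 + e) * s * t <= k%:R) binomial_pmf m p k <=
  expR (1 - (1 + e) * t ^+ 2 / 2) * expR (- (expR (- (t ^+ 2 / 2)) / 2)) ^+ l.
Proof.
move=> /andP[p0 p1] s0 s2 t1 /andP[e0 e1] hE hx hm.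
set E := expR _ in hE *; set x := t / s.
have xs : x * s = t by rewrite /x mulfVK// gt_eqF.
have x0 : 0 <= x by rewrite divr_ge0//; lra.
have p01 : 0 <= p <= 1 by rewrite ltW.
apply: (le_trans (binomial_upper_tail_chernoff _ _ p01 x0)).
rewrite -expRM_natl -expRD ler_expR.
have y1 := expR_ge1Dx x; have y2 := expR_le_quadratic x0.
set y := expR x in y1 y2 hx *.
have Np : 0 <= N * p by rewrite -s2 sqr_ge0.
have E0 : 0 < E := expR_gt0 _.
have h1 : m%:R * p * (y - 1) <=
   (N * p - l%:R * (N * p ^+ 2) / 2 + p) * (y - 1).
  by rewrite ler_wpM2r//; lra.
have h2 : N * p * (y - 1) <= N * p * (x + y * x ^+ 2 / 2).
  by rewrite ler_wpM2l//; lra.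
have e2 : N * p * x ^+ 2 = t ^+ 2 by rewrite -s2 -xs; ring.
have h3 : y * t ^+ 2 <= (1 + e) * t ^+ 2 by rewrite ler_wpM2r ?sqr_ge0.
(* The drop of the mean by l N p^2/2 lowers the exponent by at least l E t/2 >= l E/2; this is the
   geometric factor of the bound. *)
have e4 : N * p ^+ 2 * x = E * t by rewrite -hE /x; ring.
have h4 : l%:R * (N * p ^+ 2 * x) <= l%:R * (N * p ^+ 2 * (y - 1)).
  by rewrite ler_wpM2l// ler_wpM2l//; [rewrite expr2 mulrA mulr_ge0// ltW|lra].
have h5 : l%:R * E <= l%:R * (E * t) by rewrite ler_wpM2l// ler_peMr// ltW.
(* The rounding allowance [p] in the hypothesis on [m] costs the summand 1 in the exponent. *)
have h6 : p * (y - 1) <= 1 by nra.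
rewrite e4 in h4.
have e7 : x * (N * p + (1 + e) * s * t) = N * p * x + (1 + e) * t ^+ 2.
  have -> : x * (N * p + (1 + e) * s * t) = N * p * x + (1 + e) * (x * s) * t by ring.
  by rewrite xs; ring.
rewrite e7.
have e8 : N * p * (x + y * x ^+ 2 / 2) = N * p * x + y * t ^+ 2 / 2.
  by rewrite -e2; ring.
rewrite e8 in h2.
have e9 : (N * p - l%:R * (N * p ^+ 2) / 2 + p) * (y - 1) =
  N * p * (y - 1) - l%:R * (N * p ^+ 2 * (y - 1)) / 2 + p * (y - 1) by ring.
rewrite e9 in h1.
lra.
Qed.

(** With tilt [x = (1 - e / 2) * t / s] the tilted mean is at least Np + (1 - e/2)st up to a few s.
    The margin est/2 >= 104s over the level absorbs this error and the Chebyshev window of 3s. *)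
Lemma binomial_lower_tail_scaled (R : realType) (N p s t e : R) (m : nat) :
  0 < p -> 0 < s -> s ^+ 2 = N * p -> 0 <= e <= 1 / 2 ->
  1 <= s -> 1 <= t -> 208 <= e * t ->
  N * p ^+ 2 / s = expR (- (t ^+ 2 / 2)) -> expR (t / s) <= 1 + e / 4 ->
  p * expR (t / s) < 1 -> N * p - 2 * s <= m%:R * p -> m%:R * p <= N * p ->
  3 / 4 * expR (- ((1 - e / 8) * t ^+ 2 / 2)) <=
  \sum_(k < m.+1 | N * p + (1 - e) * s * t <= k%:R) binomial_pmf m p k.
Proof.
move=> p0 s0 s2 /andP[e0 e1] s1 t1 et hE hx0 px0 hm1 hm2.
set E := expR _ in hE; set x := (1 - e / 2) * t / s.
have xs : x * s = (1 - e / 2) * t by rewrite /x mulfVK// gt_eqF.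
have x0 : 0 <= x by rewrite divr_ge0// ?(ltW s0)// mulr_ge0//; lra.
have xle : x <= t / s.
  rewrite /x ler_pM2r ?invr_gt0//; nra.
have hx : expR x <= 1 + e / 4 by apply: le_trans hx0; rewrite ler_expR.
have px : p * expR x < 1.
  by apply: le_lt_trans px0; rewrite ler_wpM2l ?(ltW p0)// ler_expR.
have y1 := expR_ge1Dx x.
have xh : x <= 1 / 8 by lra.
have m0 : 0 <= m%:R * p by rewrite mulr_ge0// ltW.
have r0 : 0 <= 3 * s by lra.
(* The half-width 3s suffices because e^x <= 2 and mp <= s^2, so the left side is at most 8s^2. *)
have mr : 4 * (m%:R * (p * expR x)) <= (3 * s) ^+ 2.
  rewrite mulrA; rewrite exprMn s2; set y := expR x in hx y1 *.
  have : m%:R * p * y <= m%:R * p * (2) by rewrite ler_wpM2l//; lra.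
  nra.
have := binomial_upper_tail_ge p0 x0 px r0 mr; set y := expR x in hx y1 *.
have yx : y - 1 <= 2 * x.
  have := expR_le_quadratic x0; rewrite -/y.
  have : y * x ^+ 2 <= 2 * x ^+ 2 by rewrite ler_wpM2r ?sqr_ge0//; lra.
  nra.
have mpy : m%:R * p * y <= 2 * s ^+ 2.
  rewrite s2; have : m%:R * p * y <= m%:R * p * 2 by rewrite ler_wpM2l//; lra.
  lra.
have Et : E <= 1 by rewrite /E -[leRHS]expR0 ler_expR oppr_le0 divr_ge0// sqr_ge0.
have hps : p * s = E by rewrite -hE expr2 mulrA -s2; field; rewrite gt_eqF.
have h1 : m%:R * p * y * x ^+ 2 <= (1 + e / 4) * ((1 - e / 2) * t) ^+ 2.
  have -> : (1 + e / 4) * ((1 - e / 2) * t) ^+ 2 = s ^+ 2 * (1 + e / 4) * x ^+ 2.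
    by rewrite -xs; ring.
  rewrite ler_wpM2r ?sqr_ge0// s2; apply: ler_pM => //; lra.
(* Since [p * s = E <= 1], this part of the tilting cost is only O(t). *)
have h2 : p * (y - 1) * (m%:R * p * y + 3 * s) <= 10 * t.
  apply: (@le_trans _ _ (p * (2 * x) * (5 * s ^+ 2))).
    apply: ler_pM.
    - by apply: mulr_ge0; lra.
    - by rewrite addr_ge0// mulr_ge0// expR_ge0.
    - by rewrite ler_wpM2l// ltW.
    - have : 3 * s <= 3 * s ^+ 2 by rewrite expr2; nra.
      lra.
  have -> : p * (2 * x) * (5 * s ^+ 2) = 10 * (x * s) * (p * s) by ring.
  rewrite xs hps.
  have : (1 - e / 2) * t * E <= t * 1.
    by apply: ler_pM; rewrite ?expR_ge0//; nra.
  lra.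
have h3 : 3 * s * x <= 3 * t by rewrite -mulrA [s * x]mulrC xs; nra.
move=> tail; apply: (le_trans _ (le_trans tail _)).
  rewrite ler_pM2l ?ler_expR; last lra.
  rewrite lerN2.
  have c1 : (1 + e / 4) * (1 - e / 2) ^+ 2 <= 1 - e / 4 by nra.
  have c2 : (1 + e / 4) * (1 - e / 2) ^+ 2 * t ^+ 2 <= (1 - e / 4) * t ^+ 2.
    by rewrite ler_wpM2r ?sqr_ge0.
  (* Here 208 = 16 * 13: the costs 3t of [h3] and 10t of [h2] must fit into the gap et^2/16 between
     (1 - e/4)t^2/2 and (1 - e/8)t^2/2. *)
  have c3 : 208 * t <= e * t * t by rewrite ler_wpM2r//; lra.
  have c4 : (1 + e / 4) * ((1 - e / 2) * t) ^+ 2 =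
     (1 + e / 4) * (1 - e / 2) ^+ 2 * t ^+ 2 by ring.
  rewrite c4 in h1.
  have c5 : e * t * t = e * t ^+ 2 by ring.
  rewrite c5 in c3.
  lra.
rewrite [leLHS]big_mkcond [leRHS]big_mkcond /=; apply: ler_sum => k _.
have q0 : 0 <= binomial_pmf m p k.
  apply: binomial_pmf_ge0; rewrite (ltW p0)/=.
  by apply: le_trans (ltW px); rewrite ler_peMr ?(ltW p0)// -[leLHS]expR0 ler_expR.
case: ifPn => [hk|_]; last by case: ifPn.
rewrite ifT//; apply: le_trans hk.
have : m%:R * p * (1 + x) <= m%:R * p * y by rewrite ler_wpM2l.
have : (N * p - 2 * s) * (1 + x) <= m%:R * p * (1 + x) by rewrite ler_wpM2r//; lra.
have -> : (N * p - 2 * s) * (1 + x) = N * p - 2 * s + s * (x * s) - 2 * (s * x).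
  by rewrite -s2; ring.
have : s * x <= s * (1 / 8) by rewrite ler_pM2l.
have : s * 208 <= s * (e * t) by rewrite ler_pM2l.
rewrite xs mulrA; nra.
Qed.

(** * From single tails to the maximum of the variables *)

Lemma binomial_prob_sumE (R : realType) (p : R) (m : nat) (A : pred nat) :
  0 <= p <= 1 ->
  binomial_prob m p [set k | A k] =
  (\sum_(k < m.+1 | A k) binomial_pmf m p k)%:E.
Proof.
move=> /andP[p0 p1]; rewrite (@binomial_probE _ m p p0 p1) -sumEFin [RHS]big_mkcond /=.
apply: eq_bigr => k _; rewrite diracE mem_setE /in_mem /=.
by case: (A k); rewrite ?mule1 ?mule0.
Qed.

Lemma measurable_fun_maxn d (T : measurableType d) (f g : T -> nat) :
  measurable_fun setT f -> measurable_fun setT g ->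
  measurable_fun setT (fun u => maxn (f u) (g u)).
Proof.
move=> mf mg _ Y _; rewrite setTI.
have -> : (fun u => maxn (f u) (g u)) @^-1` Y =
  \bigcup_i \bigcup_(j in [set j | Y (maxn i j)])
    (f @^-1` [set i] `&` g @^-1` [set j]).
  apply/seteqP; split => [u Yu|u [i _ [j /= Yij [fi gj]]]].
    by exists (f u) => //; exists (g u).
  by rewrite /preimage /= fi gj.
apply: bigcupT_measurable => i; apply: bigcup_measurable => j _.
by apply: measurableI; rewrite -[_ @^-1` _]setTI; [exact: mf|exact: mg].
Qed.

Lemma measurable_fun_bigmaxn d (T : measurableType d) (f : nat -> T -> nat)
    (r : seq nat) :
  (forall i, measurable_fun setT (f i)) ->
  measurable_fun setT (fun u => \max_(i <- r) f i u).
Proof.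
move=> mf; elim: r => [|i r IH].
  by under eq_fun do rewrite big_nil; exact: measurable_cst.
by under eq_fun do rewrite big_cons; exact: measurable_fun_maxn.
Qed.

(** Union bound: the series of ratio e^(-E/2) sums to at most 1 + 2/E <= 3/E, and 1/E = e^(t^2/2)
    cancels all of the Chernoff factor except e^(1 - et^2/2). *)
Lemma binomial_max_upper (R : realType) (d : measure_display)
    (T : measurableType d) (P : probability T R) (Z : nat -> {RV P >-> nat})
    (N p s t e : R) (K : nat) (z : nat -> nat) :
  0 < p <= 1 -> 0 < s -> s ^+ 2 = N * p -> 1 <= t -> 0 <= e <= 1 ->
  N * p ^+ 2 / s = expR (- (t ^+ 2 / 2)) -> expR (t / s) <= 1 + e ->
  (forall l, (l < K)%N ->
     (z l.+1)%:R * p <= N * p - l%:R * (N * p ^+ 2) / 2 + p) ->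
  (forall l, (1 <= l <= K)%N ->
     distribution P (Z l) = binomial_prob (z l) p :> (set nat -> \bar R)) ->
  (P (\big[setU/set0]_(l < K)
        (Z l.+1 @^-1` [set k | (N * p + (1 + e) * s * t <= k%:R)%R])) <=
   (3 * expR 1 * expR (- (e * t ^+ 2 / 2)))%:E)%E.
Proof.
move=> p01 s0 s2 t1 e01 hE hx hz hd.
set A := [set k : nat | (N * p + (1 + e) * s * t <= k%:R)%R].
have mU (l : nat) : measurable (Z l @^-1` A).
  exact: (measurable_funPTI (Z l)).
set C := expR (1 - (1 + e) * t ^+ 2 / 2).
set E := expR (- (t ^+ 2 / 2)) in hE.
have E0 : 0 < E := expR_gt0 _.
apply: (@le_trans _ _ (\sum_(l < K) (C * expR (- (E / 2)) ^+ l)%:E)%E).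
  have mUK : measurable (\big[setU/set0]_(l < K) (Z l.+1 @^-1` A)).
    by apply: bigsetU_measurable => l _; exact: mU.
  apply: le_trans (@content_subadditive _ R T P _ (fun l => Z l.+1 @^-1` A) K
    (fun l _ => mU l.+1) mUK (@subset_refl _ _)) _.
  apply: lee_sum => l _.
  have lK : (1 <= l.+1 <= K)%N by rewrite ltn_ord.
  rewrite [leLHS](_ : _ = distribution P (Z l.+1) A)// hd//.
  rewrite (@binomial_prob_sumE _ _ _
    (fun k => N * p + (1 + e) * s * t <= k%:R)).
    by rewrite lee_fin; apply: binomial_upper_tail_scaled => //; exact: hz.
  by case/andP: p01 => /ltW ->.
rewrite sumEFin lee_fin -mulr_sumr.
have := @sum_expRN_le _ (E / 2) K; rewrite divr_gt0// => /(_ isT) hS.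
have E1 : E <= 1 by rewrite /E -[leRHS]expR0 ler_expR oppr_le0 divr_ge0// sqr_ge0.
apply: (@le_trans _ _ (C * (3 / E))).
  rewrite ler_wpM2l ?expR_ge0//; apply: (le_trans hS).
  by rewrite invf_div ler_pdivlMr// mulrDl mulfVK ?gt_eqF//; lra.
rewrite /C /E -expRN mulrCA -[leRHS]mulrA ler_pM2l//.
rewrite -!expRD ler_expR; lra.
Qed.

(** By independence the probability is at most (1 - c)^M <= e^(-Mc), with [c] the one-variable lower
    bound; [M] is large enough that Mc >= (3/4)e^(et^2/16). *)
Lemma binomial_max_lower (R : realType) (d : measure_display)
    (T : measurableType d) (P : probability T R) (Z : nat -> {RV P >-> nat})
    (N p s t e : R) (K M : nat) (z : nat -> nat) :
  0 < p -> 0 < s -> s ^+ 2 = N * p -> 0 <= e <= 1 / 2 ->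
  1 <= s -> 1 <= t -> 208 <= e * t ->
  N * p ^+ 2 / s = expR (- (t ^+ 2 / 2)) -> expR (t / s) <= 1 + e / 4 ->
  p * expR (t / s) < 1 -> (M <= K)%N -> expR (t ^+ 2 / 2) <= M%:R ->
  (forall l, (1 <= l <= M)%N -> N * p - 2 * s <= (z l)%:R * p <= N * p) ->
  (forall l, (1 <= l <= K)%N ->
     distribution P (Z l) = binomial_prob (z l) p :> (set nat -> \bar R)) ->
  mutually_independent [set l : nat | (1 <= l <= K)%N] Z ->
  (P (\bigcap_(l in [set l : nat | (1 <= l <= M)%N])
        (Z l @^-1` [set k | ~~ (N * p + (1 - e) * s * t <= k%:R)%R])) <=
   (2 * expR (- (e * t ^+ 2 / 16)))%:E)%E.
Proof.
move=> p0 s0 s2 e01 s1 t1 et hE hx px MK hM hz hd hi.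
pose J := [fset l in iota 1 M]%fset.
have JE l : (l \in J) = (1 <= l <= M)%N.
  by rewrite !inE /= mem_iota add1n ltnS.
have JK : [set` J] `<=` [set l : nat | (1 <= l <= K)%N].
  by move=> l /=; rewrite JE => /andP[-> lM]; exact: leq_trans MK.
set B := [set k : nat | ~~ (N * p + (1 - e) * s * t <= k%:R)].
have -> : [set l : nat | (1 <= l <= M)%N] = [set` J].
  by apply/seteqP; split => l /=; rewrite JE.
rewrite (hi J (fun=> B) JK)//.
set c := 3 / 4 * expR (- ((1 - e / 8) * t ^+ 2 / 2)).
have ex1 : 1 <= expR (t / s) by rewrite -[leLHS]expR0 ler_expR divr_ge0//; lra.
have p01 : 0 <= p <= 1.
  by rewrite (ltW p0)/=; apply: le_trans (ltW px); rewrite ler_peMr// ltW.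
pose v l := \sum_(k < (z l).+1 | ~~ (N * p + (1 - e) * s * t <= k%:R)) binomial_pmf (z l) p k.
have PE l : l \in J -> P (Z l @^-1` B) = (v l)%:E.
  rewrite JE => lM; have -> : P (Z l @^-1` B) = distribution P (Z l) B by [].
  rewrite hd; last by case/andP: lM => -> /= lM; exact: leq_trans MK.
  by rewrite (@binomial_prob_sumE _ _ _ (fun k => ~~ (N * p + (1 - e) * s * t <= k%:R))).
rewrite big_seq (eq_bigr (fun l => (v l)%:E)) -?big_seq => [|l lJ]; last exact: PE.
rewrite prodEFin lee_fin.
have v0 l : 0 <= v l by apply: sumr_ge0 => k _; exact: binomial_pmf_ge0.
have v1 l : l \in J -> v l <= expR (- c).
  rewrite JE => lM; apply: le_trans (expR_ge1Dx _).
  have /andP[z1 z2] := hz l lM.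
  have := binomial_lower_tail_scaled p0 s0 s2 e01 s1 t1 et hE hx px z1 z2.
  have := binomial_pmf_sum1 p (z l).
  rewrite (bigID (fun k : 'I_ _ => N * p + (1 - e) * s * t <= k%:R)) /= -/(v l) -/c.
  by lra.
apply: (@le_trans _ _ (\prod_(l <- J) expR (- c))).
  rewrite big_seq [leRHS]big_seq; apply: ler_prod => l lJ.
  by rewrite v0 v1.
have -> : \prod_(l <- J) expR (- c) = expR (- c) ^+ M.
  rewrite big_const_seq count_predT -[in RHS](size_iota 1 M).
  rewrite (_ : size J = size (iota 1 M)); last first.
    by have := card_fseq (iota 1 M); rewrite undup_id ?iota_uniq.
  by elim: (size _) => //= n ->; rewrite exprS.
rewrite -expRM_natl mulrN [leLHS]expRN.
set y := expR (M%:R * c).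
have c0 : 0 < c by rewrite mulr_gt0 ?expR_gt0.
have : 3 / 4 * expR (e * t ^+ 2 / 16) <= M%:R * c.
  apply: le_trans (ler_wpM2r (ltW c0) hM).
  rewrite /c [leRHS]mulrCA ler_pM2l; last lra.
  rewrite -expRD ler_expR; lra.
(* The bound e^(-Mc) is weakened to 1/(1 + Mc), which already has the exponential form needed beside
   the upper tail. *)
have := expR_ge1Dx (M%:R * c); rewrite -/y => h1 h2.
have w0 := expR_gt0 (e * t ^+ 2 / 16); set w := expR _ in h2 w0 *.
rewrite expRN -/w -[2]invrK -invfM lef_pV2 ?posrE ?expR_gt0 ?mulr_gt0//.
by lra.
Qed.

(** A deviation beyond [e'] forces either some variable up to the level for 1 + e, or the first [M]
    variables all below the level for 1 - e. Keeping [e] apart from [e'] allows [e <= 1 / 2] with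
    [e'] arbitrarily large. *)
Lemma binomial_max_concentration (R : realType) (d : measure_display)
    (T : measurableType d) (P : probability T R) (Z : nat -> {RV P >-> nat})
    (N p s t e e' : R) (K M : nat) (z : nat -> nat) :
  0 < p -> s ^+ 2 = N * p -> 0 < e <= 1 / 2 -> e <= e' ->
  1 <= s -> 1 <= t -> 208 <= e * t ->
  N * p ^+ 2 / s = expR (- (t ^+ 2 / 2)) -> expR (t / s) <= 1 + e / 4 ->
  p * expR (t / s) < 1 -> (M <= K)%N -> expR (t ^+ 2 / 2) <= M%:R ->
  (forall l, (l < K)%N ->
     (z l.+1)%:R * p <= N * p - l%:R * (N * p ^+ 2) / 2 + p) ->
  (forall l, (1 <= l <= M)%N -> N * p - 2 * s <= (z l)%:R * p <= N * p) ->
  (forall l, (1 <= l <= K)%N ->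
     distribution P (Z l) = binomial_prob (z l) p :> (set nat -> \bar R)) ->
  mutually_independent [set l : nat | (1 <= l <= K)%N] Z ->
  (P [set u | (e' < `|((\max_(1 <= l < K.+1) Z l u)%N%:R - N * p) / (s * t) - 1|)%R] <=
   ((3 * expR 1 + 2) * expR (- (e * t ^+ 2 / 16)))%:E)%E.
Proof.
move=> p0 s2 /andP[e0 e1] ee' s1 t1 et hE hx px MK hM hzu hzl hd hi.
have s0 : 0 < s by lra.
have st0 : 0 < s * t by rewrite mulr_gt0//; lra.
have ex1 : 1 <= expR (t / s) by rewrite -[leLHS]expR0 ler_expR divr_ge0//; lra.
have p1 : p <= 1 by apply: le_trans (ltW px); rewrite ler_peMr// ltW.
have hU := binomial_max_upper (P := P) (Z := Z) (K := K) (z := z) (e := e).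
have {}hU := hU N p s t.
have {}hU := hU _ s0 s2 t1 _ hE _ hzu hd.
have hL := binomial_max_lower (P := P) (Z := Z) (K := K) (z := z) (e := e).
have {}hL := hL N p s t M p0 s0 s2 _ s1 t1 et hE hx px MK hM hzl hd hi.
set U := \big[setU/set0]_(l < K) _ in hU.
set V := \bigcap_(l in _) _ in hL.
have mZ (l : nat) (A : set nat) : measurable (Z l @^-1` A).
  exact: (measurable_funPTI (Z l)).
have mU : measurable U by apply: bigsetU_measurable => l _; exact: mZ.
have mV : measurable V by apply: bigcap_measurableType => l _; exact: mZ.
set X := [set u | _].
have mX : measurable X.
  have := @measurable_fun_bigmaxn _ _ (fun l => Z l : T -> nat) (index_iota 1 K.+1).
  move=> /(_ (fun l => measurable_funPT (Z l))).
  move=> /(_ measurableT [set j | e' < `|(j%:R - N * p) / (s * t) - 1|]).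
  by rewrite setTI; apply.
have XUV : X `<=` U `|` V.
  move=> u; rewrite /X /=; set mx := (\max_(1 <= l < K.+1) Z l u)%N.
  move=> /(le_lt_trans ee'); rewrite ltNge => /negP nX.
  case: (lerP (N * p + (1 + e) * s * t) mx%:R) => hup.
    left.
    have [l lK lu] : exists2 l, (l < K)%N & N * p + (1 + e) * s * t <= (Z l.+1 u)%:R.
      apply: contrapT => nex.
      have : forall l, (l < K)%N -> (Z l.+1 u)%:R < N * p + (1 + e) * s * t.
        by move=> l lK; rewrite ltNge; apply/negP => h; apply: nex; exists l.
      move=> hlt; suff : mx%:R < N * p + (1 + e) * s * t by rewrite ltNge hup.
      rewrite /mx big_add1 /= big_mkord.
      (* The induction starts from 0, the value of an empty maximum, which lies below the positive
         level. *)
      apply: (big_ind (fun j : nat => j%:R < N * p + (1 + e) * s * t)).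
      - by rewrite -s2; nra.
      - by move=> a b ha hb; rewrite /maxn; case: ifP.
      - by move=> i _; exact: hlt.
    rewrite [U](_ : _ = \bigcup_(l < K) (Z l.+1 @^-1`
      [set k | N * p + (1 + e) * s * t <= k%:R])).
      by exists l.
    by rewrite bigcup_mkord.
  right.
  move=> l /= /andP[l1 lM]; apply/negP => hl; apply: nX.
  have lmx : (Z l u <= mx)%N.
    rewrite /mx; apply: (@leq_bigmax_seq _ _ xpredT (fun l => Z l u)) => //.
    by rewrite mem_index_iota l1 ltnS (leq_trans lM).
  have hlow : N * p + (1 - e) * s * t <= mx%:R.
    by apply: (le_trans hl); rewrite ler_nat.
  rewrite ler_norml !lerBrDr ler_pdivlMr// ?lerBlDr ler_pdivrMr//.
  apply/andP; split; lra.
apply: (@le_trans _ _ (P U + P V)%E).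
  apply: le_trans (measureU2 P mU mV).
  by apply: le_measure; rewrite ?inE//; exact: measurableU.
apply: (le_trans (leeD (hU _ _ _) (hL _))).
- by rewrite p0.
- by rewrite ltW//=; lra.
- by lra.
- by rewrite ltW//=.
rewrite -EFinD lee_fin [leRHS]mulrDl lerD2r ler_pM2l ?mulr_gt0 ?expR_gt0//.
rewrite ler_expR; have : 0 <= e * t ^+ 2 by rewrite mulr_ge0 ?sqr_ge0// ltW.
lra.
Qed.

(** * Rounded binomial sizes *)

Lemma rounding_bounds (R : realType) (x : R) (m : nat) :
  rounding x m -> x - 1 <= m%:R <= x + 1.
Proof.
have mZ : (m%:R : R) = m%:Z%:~R by [].
case=> h; rewrite mZ h.
  have := floor_le_tmp x; have := lt_succ_floor x; rewrite intrD; lra.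
have := ceil_ge x; have := gt_pred_ceil x; rewrite intrB; lra.
Qed.

(** An integer upper bound survives rounding up; this yields z_l <= n without an additive error. *)
Lemma rounding_le (R : realType) (x : R) (m n : nat) :
  rounding x m -> x <= n%:R -> (m <= n)%N.
Proof.
move=> h xn; rewrite -lez_nat.
have hc : (Num.ceil x <= n%:Z) by rewrite ceil_le_int.
case: h => ->//; apply: le_trans hc; rewrite -(ler_int R); exact: le_trans (floor_le_tmp x) (ceil_ge x).
Qed.

(** Since lp <= 1, the quadratic term of [zpar n p l.+1] is at most half the linear one, so the
    value lies between n - lnp and n - lnp/2; rounding costs [p] after multiplication by [p]. *)
Lemma rounding_zpar_bounds (R : realType) (n l m : nat) (p : R) :
  0 <= p <= 1 -> l%:R * p <= 1 -> rounding (zpar n p l.+1) m ->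
  [/\ m%:R * p <= n%:R * p - l%:R * (n%:R * p ^+ 2) / 2 + p,
      n%:R * p - l%:R * (n%:R * p ^+ 2) - p <= m%:R * p &
      m%:R * p <= n%:R * p].
Proof.
move=> /andP[p0 p1] lp hr; have [h1 h2] := andP (rounding_bounds hr).
have n0 : 0 <= n%:R :> R by [].
have l0 : 0 <= l%:R :> R by [].
have zE : zpar n p l.+1 = n%:R - l%:R * (n%:R * p) + l%:R * (l%:R - 1) * (n%:R * p ^+ 2) / 2.
  by rewrite /zpar -[l.+1%:R]natr1; field.
have zu : zpar n p l.+1 <= n%:R - l%:R * (n%:R * p) / 2.
  rewrite zE; have : (l%:R * (n%:R * p)) * (l%:R * p) <= (l%:R * (n%:R * p)) * 1.
    by rewrite ler_wpM2l// !mulr_ge0.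
  have : 0 <= l%:R * (n%:R * p ^+ 2) by rewrite !mulr_ge0// sqr_ge0.
  lra.
have zl : n%:R - l%:R * (n%:R * p) <= zpar n p l.+1.
  (* The factor l - 1 is negative at l = 0, where the product l(l - 1) still vanishes. *)
  rewrite zE; case: l {h1 h2 hr lp l0 zE zu} => [|l]; first by rewrite !mul0r; lra.
  rewrite -[l.+1%:R]natr1 addrK lerDl.
  by rewrite !mulr_ge0 ?addr_ge0 ?invr_ge0 ?sqr_ge0.
have np0 : 0 <= l%:R * (n%:R * p) by rewrite !mulr_ge0.
split.
- have : m%:R * p <= (n%:R - l%:R * (n%:R * p) / 2 + 1) * p by rewrite ler_wpM2r//; lra.
  lra.
- have : (n%:R - l%:R * (n%:R * p) - 1) * p <= m%:R * p by rewrite ler_wpM2r//; lra.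
  lra.
- rewrite ler_wpM2r// ler_nat; apply: (rounding_le hr); lra.
Qed.

(** * Asymptotic regime of the parameters *)

Lemma near_nat_powR_ge (R : realType) (r A : R) : 0 < r ->
  \forall n \near \oo, A <= n%:R `^ r.
Proof.
move=> r0; near=> n.
have A0 : A <= Num.max A 1 by rewrite le_max lexx.
apply: (le_trans A0); have M0 : 0 <= Num.max A 1 by rewrite le_max ler01 orbT.
have -> : Num.max A 1 = (Num.max A 1 `^ r^-1) `^ r.
  by rewrite -powRrM mulVf ?gt_eqF// powRr1.
apply: (ge0_ler_powR (ltW r0)); rewrite ?nnegrE ?powR_ge0//.
near: n; exact: nbhs_infty_ger.
Unshelve. all: by end_near. Qed.

(** Cubing np <= e^(-A/3) n^(2/3) and dividing by n^2 gives np^3 <= e^(-A). *)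
Lemma near_ln_density_ge (R : realType) (p : nat -> R) (A : R) :
  (\forall n \near \oo, 0 < p n) ->
  (fun n => n%:R * p n : R^o) =o_\oo (fun n => n%:R `^ (2 / 3) : R^o) ->
  \forall n \near \oo, A <= ln (1 / (n%:R * p n ^+ 3)).
Proof.
move=> p0 /eqoP /(_ (expR (- (A / 3))) (expR_gt0 _)) hp; near=> n.
have n0 : 0 < n%:R :> R by rewrite ltr0n; near: n; exact: nbhs_infty_gt.
have pn : 0 < p n by near: n.
have : `|n%:R * p n| <= expR (- (A / 3)) * `|n%:R `^ (2 / 3)| by near: n.
rewrite ger0_norm ?(ltW (mulr_gt0 n0 pn))// ger0_norm ?powR_ge0// => h.
have : (n%:R * p n) ^+ 3 <= (expR (- (A / 3)) * n%:R `^ (2 / 3)) ^+ 3.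
  by rewrite lerXn2r ?nnegrE ?mulr_ge0 ?expR_ge0 ?powR_ge0 ?(ltW pn).
rewrite [leRHS]exprMn -expRM_natl -[(_ `^ _) ^+ 3]powR_mulrn ?powR_ge0// -powRrM.
rewrite (_ : 3 * - (A / 3) = - A); last by field.
rewrite (_ : 2 / 3 * 3 = 2); last by field.
rewrite powR_mulrn// => {}h.
have q0 : 0 < n%:R * p n ^+ 3 by rewrite mulr_gt0// exprn_gt0.
rewrite div1r lnV ?posrE// lerNr -[leRHS]expRK ler_ln ?posrE ?expR_gt0//.
rewrite -(ler_pM2r (exprn_gt0 2 n0)).
by rewrite (_ : _ * _ * _ = (n%:R * p n) ^+ 3) //; ring.
Unshelve. all: by end_near. Qed.

Lemma expR_le1Dx4 (R : realType) (x e : R) : 0 < e <= 1 / 2 -> x <= e / 8 ->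
  expR x <= 1 + e / 4.
Proof.
move=> /andP[e0 e1] xe; have := expR_ge1Dx (- x); rewrite expRN => h.
have x1 : 0 < 1 - x by lra.
have : expR x <= (1 - x)^-1.
  by rewrite -[leLHS]invrK lef_pV2 ?posrE ?invr_gt0 ?expR_gt0.
move=> /le_trans; apply; rewrite -[leLHS]mul1r ler_pdivrMr//; nra.
Qed.

(* With [w = n^(1/8)] the bound [np >= n^(5/8)] becomes polynomial in [w]. *)
Lemma binomial_max_concentration_regime (R : realType) (d : measure_display)
    (T : measurableType d) (P : probability T R) (Z : nat -> {RV P >-> nat})
    (p w e e' : R) (n : nat) (z : nat -> nat) :
  n%:R = w ^+ 8 -> 200 ^+ 2 <= w -> 8 / e <= w -> 0 < e <= 1 / 2 -> e <= e' ->
  0 < p -> w ^+ 5 <= n%:R * p ->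
  (208 / e) ^+ 2 <= ln (1 / (n%:R * p ^+ 3)) ->
  (forall l, (1 <= l <= 2 * kpar n p)%N -> rounding (zpar n p l) (z l)) ->
  (forall l, (1 <= l <= 2 * kpar n p)%N ->
     distribution P (Z l) = binomial_prob (z l) p :> (set nat -> \bar R)) ->
  mutually_independent [set l : nat | (1 <= l <= 2 * kpar n p)%N] Z ->
  (P [set u | (e' < `|((\max_(1 <= l < (2 * kpar n p).+1) Z l u)%N%:R - n%:R * p)
      / Num.sqrt (n%:R * p * ln (1 / (n%:R * p ^+ 3))) - 1|)%R] <=
   ((3 * expR 1 + 2) * expR (- (e * ln (1 / (n%:R * p ^+ 3)) / 16)))%:E)%E.
Proof.
move=> hn w3 we /andP[e0 e1] ee' p0 hw hL hr hd hi.
set N : R := n%:R in hn hw hL *; set L := ln _ in hL *.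
have w0 : 0 < w by lra.
have N0 : 0 < N by rewrite hn exprn_gt0.
have q0 : 0 < N * p ^+ 3 by rewrite mulr_gt0// exprn_gt0.
have Np0 : 0 < N * p by rewrite mulr_gt0.
have e208 : 0 <= 208 / e by rewrite divr_ge0// ltW.
have L0 : 0 <= L by apply: le_trans hL; exact: sqr_ge0.
have qL : expR (- L) = N * p ^+ 3.
  by rewrite /L div1r lnV ?posrE// opprK lnK.
pose s := Num.sqrt (N * p); pose t := Num.sqrt L.
have s2 : s ^+ 2 = N * p by rewrite sqr_sqrtr// ltW.
have t2 : t ^+ 2 = L by rewrite sqr_sqrtr.
have s0 : 0 < s by rewrite sqrtr_gt0.
have t208 : 208 / e <= t by rewrite -[leLHS]ger0_norm// -sqrtr_sqr ler_wsqrtr.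
have et : 208 <= e * t by rewrite mulrC -ler_pdivrMr.
have t1 : 1 <= t by nra.
have stE : Num.sqrt (N * p * L) = s * t by rewrite sqrtrM// ltW.
have w1 : 1 <= w by lra.
have Np1 : 1 <= N * p by apply: le_trans hw; rewrite exprn_ege1.
have s1 : 1 <= s by rewrite -[leLHS]sqrtr1 ler_wsqrtr.
have q1 : N * p ^+ 3 <= 1 by rewrite -qL -[leRHS]expR0 ler_expR oppr_le0.
have Nw : w <= N by rewrite hn exprSr ler_peMl ?(ltW w0)// exprn_ege1.
have p4 : p <= 1 / 4.
  rewrite leNgt; apply/negP => p4.
  have : (1 / 4) ^+ 3 < p ^+ 3 by rewrite ltrXn2r ?nnegrE//; lra.
  have : 200 ^+ 2 * p ^+ 3 <= N * p ^+ 3.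
    by rewrite ler_wpM2r ?exprn_ge0 ?(ltW p0)//; lra.
  lra.
(* From (Np)^2 >= w^10 and N = w^8. *)
have Np2 : w ^+ 2 <= N * p ^+ 2.
  rewrite -(ler_pM2l N0) [leRHS](_ : _ = (N * p) ^+ 2); last by ring.
  rewrite [leLHS](_ : _ = (w ^+ 5) ^+ 2); last by rewrite hn; ring.
  by rewrite lerXn2r ?nnegrE ?exprn_ge0// ltW.
have Np20 : 0 < N * p ^+ 2 by rewrite mulr_gt0// exprn_gt0.
have hE : N * p ^+ 2 / s = expR (- (t ^+ 2 / 2)).
  apply/eqP; rewrite -(eqrXn2 (n := 2))// ?expR_ge0 ?divr_ge0 ?(ltW Np20) ?(ltW s0)//.
  rewrite -expRM_natl t2 (_ : 2 * - (L / 2) = - L); last by field.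
  by rewrite qL expr_div_n s2; apply/eqP; field; rewrite !gt_eqF.
(* Squared, this reads L/(Np) <= 1/(Np^2)^2, which is ln y <= y at y = 1/(Np^3). *)
have ts : t / s <= (N * p ^+ 2)^-1.
  rewrite -(ler_pXn2r (n := 2)) ?nnegrE ?invr_ge0 ?(ltW Np20) ?divr_ge0 ?(ltW s0)//; last lra.
  rewrite expr_div_n t2 s2 ler_pdivrMr//.
  have := ln_sublinear (_ : 0 < 1 / (N * p ^+ 3)).
  rewrite divr_gt0// => /(_ isT) /ltW /le_trans; apply.
  by rewrite le_eqVlt; apply/orP; left; apply/eqP; field; rewrite !gt_eqF.
have tse : t / s <= e / 8.
  apply: (le_trans ts); rewrite -[leRHS]invrK lef_pV2 ?posrE ?invr_gt0 ?divr_gt0//.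
  by rewrite invf_div; apply: (le_trans we); apply: le_trans Np2; rewrite ler_eXnr.
have hx : expR (t / s) <= 1 + e / 4 by apply: expR_le1Dx4; rewrite ?e0.
have hpx : p * expR (t / s) < 1.
  have : p * expR (t / s) <= 1 / 4 * (1 + e / 4).
    by apply: ler_pM => //; rewrite ?(ltW p0) ?expR_ge0.
  lra.
have exM : expR (t ^+ 2 / 2) = s / (N * p ^+ 2).
  by rewrite -[t ^+ 2 / 2]opprK expRN -hE invf_div.
pose g := Num.sqrt (N^-1 * ln N).
have lnNw : ln N <= 8 * w.
  rewrite hn lnXn// mulr_natl lerMn2r ltW//; exact: ln_sublinear.
have lnN1 : 1 <= ln N.
  have h1 : -1 < w^-1 - 1 by rewrite ltrBrDr addNr invr_gt0.
  have := le_ln1Dx h1; rewrite addrCA subrr addr0 lnV ?posrE// => h2.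
  have h3 : w^-1 <= 1 / 2 by rewrite invf_ple ?posrE//; lra.
  rewrite hn lnXn// -mulr_natr; lra.
have g2 : g ^+ 2 = N^-1 * ln N.
  by rewrite sqr_sqrtr// mulr_ge0 ?invr_ge0 ?(ltW N0)//; lra.
have g0 : 0 <= g by exact: sqrtr_ge0.
(* It suffices that 8w <= w^2/60^2, that is w >= 28800, which 200^2 exceeds. The 60 makes 15 p^(-2)
   g p <= 1/4, hence kp <= 1/2 and lp <= 1 for all l < 2k. *)
have gp : g <= p / 60.
  rewrite -(ler_pXn2r (n := 2)) ?nnegrE ?divr_ge0 ?(ltW p0)// g2.
  rewrite -(ler_pM2l N0) mulrA divff ?gt_eqF// mul1r.
  apply: (le_trans lnNw).
  have : w ^+ 2 / 60 ^+ 2 <= N * p ^+ 2 / 60 ^+ 2 by rewrite ler_wpM2r ?invr_ge0 ?exprn_ge0.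
  have -> : N * p ^+ 2 / 60 ^+ 2 = N * (p / 60) ^+ 2 by field.
  apply: le_trans; nra.
set k := kpar n p in hr hd hi *.
have kE : k%:Z = Num.ceil (15 * p ^- 2 * g).
  by rewrite /k /kpar -/N -/g gez0_abs// ceil_ge0; apply: (@lt_le_trans _ _ 0);
    rewrite ?mulr_ge0 ?invr_ge0 ?exprn_ge0 ?(ltW p0)//; lra.
have kR : k%:R <= 15 * p ^- 2 * g + 1.
  have := ceilB1_lt (15 * p ^- 2 * g); rewrite -kE intrB => /ltW.
  by rewrite lerBlDr.
have kp : k%:R * p <= 1 / 2.
  have : k%:R * p <= (15 * p ^- 2 * g + 1) * p by rewrite ler_wpM2r// ltW.
  have : 15 * p ^- 2 * g <= 15 * p ^- 2 * (p / 60).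
    by rewrite ler_wpM2l// mulr_ge0 ?invr_ge0 ?exprn_ge0 ?(ltW p0).
  move=> /(ler_wpM2r (ltW p0)).
  have -> : 15 * p ^- 2 * (p / 60) * p = 1 / 4 by field; rewrite gt_eqF.
  lra.
pose M := `|Num.ceil (expR (t ^+ 2 / 2))|%N.
have ME : M%:Z = Num.ceil (expR (t ^+ 2 / 2)).
  by rewrite /M gez0_abs// ceil_ge0 (lt_trans _ (expR_gt0 _))//; lra.
have hM : expR (t ^+ 2 / 2) <= M%:R.
  by have := ceil_ge (expR (t ^+ 2 / 2)); rewrite -ME.
have hM1 : M%:R - 1 <= expR (t ^+ 2 / 2).
  by have := ceilB1_lt (expR (t ^+ 2 / 2)); rewrite -ME intrB => /ltW.
(* By [exM] the claim reduces to s/N <= 15g; squaring and multiplying by N turns this into p <= 15^2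
   ln N. *)
have Mk : (M <= 2 * k)%N.
  apply: (@leq_trans k); last by rewrite mul2n -addnn leq_addr.
  rewrite -lez_nat ME kE le_ceil// exM.
  have : s / N <= 15 * g.
    rewrite -(ler_pXn2r (n := 2)) ?nnegrE ?divr_ge0 ?mulr_ge0 ?(ltW N0) ?(ltW s0)//.
    rewrite expr_div_n s2 exprMn g2 -(ler_pM2l N0).
    have -> : N * (N * p / N ^+ 2) = p by field; rewrite gt_eqF.
    have -> : N * (15 ^+ 2 * (N^-1 * ln N)) = 15 ^+ 2 * ln N by field; rewrite gt_eqF.
    lra.
  have pp : 0 <= p ^- 2 by rewrite invr_ge0 exprn_ge0// ltW.
  move=> /(ler_wpM2r pp).
  have -> : s / N * p ^- 2 = s / (N * p ^+ 2) by field; rewrite !gt_eqF.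
  by rewrite mulrAC.
have pb : 0 <= p <= 1 by rewrite (ltW p0)/=; lra.
have jp l : (l < 2 * k)%N -> l%:R * p <= 1.
  move=> lk; have : l%:R * p <= (2 * k)%:R * p by rewrite ler_wpM2r ?(ltW p0)// ler_nat ltnW.
  rewrite natrM; lra.
have zb l : (l < 2 * k)%N -> _ := fun lk =>
  rounding_zpar_bounds pb (jp l lk) (hr l.+1 lk).
rewrite stE -t2.
apply: (binomial_max_concentration (M := M) (z := z)) => //.
- by rewrite e0.
- by move=> l /zb[].
(* An index l + 1 <= M has l <= M - 1 <= e^(t^2/2) = s/(Np^2), so the mean drops by at most s; the
   rounding error p <= s accounts for the second s. *)
- case=> // l /andP[_ lM].
  have [_ z1 z2] := zb l (leq_trans lM Mk).
  rewrite z2 andbT; apply: le_trans z1.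
  have : l%:R * (N * p ^+ 2) <= expR (t ^+ 2 / 2) * (N * p ^+ 2).
    rewrite ler_wpM2r ?(ltW Np20)//; apply: le_trans hM1.
    by rewrite lerBrDr natr1 ler_nat.
  rewrite exM mulfVK ?gt_eqF//.
  rewrite -/N; lra.
Qed.


Theorem lemma3p24 (R : realType) (eps : R) (p : nat -> R)
    (z : nat -> nat -> nat)
    (d : nat -> measure_display) (T : forall n, measurableType (d n))
    (P : forall n, probability (T n) R)
    (Z : forall n, nat -> {RV (P n) >-> nat}) :
  0 < eps < 1 / 24 ->
  (\forall n \near \oo, n%:R `^ (5 / 8 + eps) <= n%:R * p n) ->
  (fun n => n%:R * p n : R^o) =o_\oo (fun n => n%:R `^ (2 / 3) : R^o) ->
  (\forall n \near \oo, forall l : nat, (1 <= l <= 2 * kpar n (p n))%N ->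
     rounding (zpar n (p n) l) (z n l)) ->
  (\forall n \near \oo, forall l : nat, (1 <= l <= 2 * kpar n (p n))%N ->
     distribution (P n) (Z n l) = binomial_prob (z n l) (p n)
       :> (set nat -> \bar R)) ->
  (\forall n \near \oo,
     mutually_independent
       [set l : nat | (1 <= l <= 2 * kpar n (p n))%N] (Z n)) ->
  cvg_in_probability P
    (fun n t =>
       ((\max_(1 <= l < (2 * kpar n (p n)).+1) Z n l t)%N%:R - n%:R * p n)
       / Num.sqrt (n%:R * p n * ln (1 / (n%:R * p n ^+ 3))))
    1.
Proof.
move=> /andP[eps0 _] hp ho hr hd hi e' e'0.
have p0 : \forall n \near \oo, 0 < p n.
  near=> n.
  have n0 : 0 < n%:R :> R by rewrite ltr0n; near: n; exact: nbhs_infty_gt.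
  rewrite -(pmulr_rgt0 _ n0); apply: lt_le_trans (powR_gt0 _ n0) _; near: n.
  exact: hp.
(* The concentration bound needs a tolerance of at most 1/2. *)
pose e := Num.min e' (1 / 2).
have e0 : 0 < e by rewrite lt_min e'0 /=; lra.
have e2 : e <= 1 / 2 by rewrite ge_min lexx orbT.
have ee' : e <= e' by rewrite ge_min lexx.
pose L n := ln (1 / (n%:R * p n ^+ 3)).
pose C := 3 * expR 1 + 2 : R.
have C0 : 0 < C by rewrite addr_gt0 ?mulr_gt0 ?expR_gt0.
apply: (@squeeze_cvge _ _ _ _ (fun=> 0%E) _ (fun n => (C * expR (- (e * L n / 16)))%:E)).
- near=> n; rewrite measure_ge0 /=.
  have n1 : 1 <= n%:R :> R by rewrite ler1n; near: n; exact: nbhs_infty_gt.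
  have w2 : 200 ^+ 2 <= n%:R `^ 8^-1 :> R.
    by near: n; apply: near_nat_powR_ge; rewrite invr_gt0.
  have we : 8 / e <= n%:R `^ 8^-1.
    by near: n; apply: near_nat_powR_ge; rewrite invr_gt0.
  apply: (binomial_max_concentration_regime (z := z n) (w := n%:R `^ 8^-1)) => //.
  + by rewrite -powR_mulrn ?powR_ge0// -powRrM mulVf// powRr1.
  + by rewrite e0.
  + by near: n.
  + have : n%:R `^ (5 / 8 + eps) <= n%:R * p n by near: n.
    apply: le_trans; rewrite -powR_mulrn ?powR_ge0// -powRrM ler_powR//; lra.
  + by near: n; exact: near_ln_density_ge.
  + by near: n.
  + by near: n.
  + by near: n.
- exact: cvg_cst.
- apply: cvg_EFin; first by near=> n.
  apply/cvgr0Pnorm_le => r r0; near=> n.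
  rewrite ger0_norm ?mulr_ge0 ?expR_ge0 ?(ltW C0)//.
  (* This threshold gives y = eL/16 >= C/r, and then C e^(-y) <= C/(1 + y) <= r. *)
  have hL : 16 * C / (e * r) <= L n by near: n; exact: near_ln_density_ge.
  have eL : C / r <= e * L n / 16.
    by move: hL; rewrite !ler_pdivrMr ?mulr_gt0//; lra.
  rewrite [leLHS](_ : _ = C * expR (- (e * L n / 16)))//.
  rewrite expRN -ler_pdivlMr ?invr_gt0 ?expR_gt0// invrK.
  have := expR_ge1Dx (e * L n / 16) => h.
  apply: (@le_trans _ _ (r * (C / r))); first by rewrite mulrC mulfVK ?gt_eqF.
  rewrite ler_pM2l//; lra.
Unshelve. all: by end_near. Qed.
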